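(* Let $G$ be a Lie group, with Lie algebra $\{\mathfrak{g},[\cdot,\cdot]_{\mathfrak{g}}\}$, acting from the left on a manifold $\mathcal{M}$. Let the Lie bracket $[\cdot,\cdot]\colon\Omega^0(\mathcal{M},\mathfrak{g})\times\Omega^0(\mathcal{M},\mathfrak{g})\to\Omega^0(\mathcal{M},\mathfrak{g})$ and the product $\triangleright\colon\Omega^0(\mathcal{M},\mathfrak{g})\times\Omega^0(\mathcal{M},\mathfrak{g})\to\Omega^0(\mathcal{M},\mathfrak{g})$ be defined pointwise at $u\in\mathcal{M}$ by $$[x,y](u)=[x(u),y(u)]_{\mathfrak{g}},\qquad x\triangleright y=\lambda_*(x)(y),$$ where $\lambda_*(x)(y)$ is the Lie derivative of $y$ along the vector field $\lambda_*(x)$. Then $\{\Omega^0(\mathcal{M},\mathfrak{g}),[\cdot,\cdot],\triangleright\}$ is a post-Lie algebra.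
   Context: $\Omega^0(\mathcal{M},\mathfrak{g})$ is the space of $\mathfrak{g}$-valued $0$-forms on $\mathcal{M}$, i.e. of (smooth) maps from $\mathcal{M}$ to $\mathfrak{g}$. Writing the left action as $(g,u)\mapsto g\cdot u$, each $x\in\Omega^0(\mathcal{M},\mathfrak{g})$ generates the vector field $\lambda_*(x)$ on $\mathcal{M}$ given by $\lambda_*(x)(u)=\left.\frac{\partial}{\partial t}\right|_{t=0}\exp(t\,x(u))\cdot u\in T_u\mathcal{M}$. Post-Lie algebra: a Lie algebra $\{\mathcal{A},[\cdot,\cdot]\}$ together with a bilinear product $\triangleright\colon\mathcal{A}\times\mathcal{A}\to\mathcal{A}$ such that for all $x,y,z\in\mathcal{A}$: $x\triangleright[y,z]=[x\triangleright y,z]+[y,x\triangleright z]$ and $[x,y]\triangleright z=a_\triangleright(x,y,z)-a_\triangleright(y,x,z)$, where $a_\triangleright(x,y,z):=x\triangleright(y\triangleright z)-(x\triangleright y)\triangleright z$.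
   Formalization: The bracket of the Lie algebra of G is taken to be that of right-invariant vector fields (the opposite of the usual left-invariant one); with the left-invariant bracket the claim fails, e.g. for a non-abelian G acting on itself by left translation. *)

(* Defs.v *)
From HB Require Import structures.
From mathcomp Require Import all_boot all_order all_algebra.
From mathcomp Require Import all_classical all_reals all_analysis.
Set Implicit Arguments.
Unset Strict Implicit.
Unset Printing Implicit Defensive.
Import Order.TTheory GRing.Theory Num.Theory numFieldNormedType.Exports.
Local Open Scope classical_set_scope.
Local Open Scope ring_scope.

(* The underlying space is a linear subspace [A] of [V] on which the operations
   are defined: the smooth maps form a subspace of the space of all maps, and
   being closed under the operations is part of the axioms. *)
Record lie_algebra_on (K : comNzRingType) (V : lmodType K) (A : set V)
    (br : V -> V -> V) : Prop := LieAlgebraOn {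
  lie_zero : A 0;
  lie_linear : forall a x y, A x -> A y -> A (a *: x + y);
  lie_closed : forall x y, A x -> A y -> A (br x y);
  lie_linearl : forall a x y z, A x -> A y -> A z ->
    br (a *: x + y) z = a *: br x z + br y z;
  lie_linearr : forall a x y z, A x -> A y -> A z ->
    br x (a *: y + z) = a *: br x y + br x z;
  lie_alternating : forall x, A x -> br x x = 0;
  lie_jacobi : forall x y z, A x -> A y -> A z ->
    br x (br y z) + br y (br z x) + br z (br x y) = 0 }.

Definition associator (V : zmodType) (tr : V -> V -> V) (x y z : V) : V :=
  tr x (tr y z) - tr (tr x y) z.

Record post_lie_algebra_on (K : comNzRingType) (V : lmodType K) (A : set V)
    (br tr : V -> V -> V) : Prop := PostLieAlgebraOn {
  post_lie_lie : lie_algebra_on A br;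
  post_lie_closed : forall x y, A x -> A y -> A (tr x y);
  post_lie_linearl : forall a x y z, A x -> A y -> A z ->
    tr (a *: x + y) z = a *: tr x z + tr y z;
  post_lie_linearr : forall a x y z, A x -> A y -> A z ->
    tr x (a *: y + z) = a *: tr x y + tr x z;
  post_lie_derivation : forall x y z, A x -> A y -> A z ->
    tr x (br y z) = br (tr x y) z + br y (tr x z);
  post_lie_associator : forall x y z, A x -> A y -> A z ->
    tr (br x y) z = associator tr x y z - associator tr y x z }.

(* [Ck k U f]: f is of class C^k on the open set U (the domains E used below
   are all finite dimensional). *)
Fixpoint Ck (R : realType) (E F : normedModType R) (k : nat) (U : set E)
    (f : E -> F) : Prop :=
  match k with
  | 0 => forall x, U x -> {for x, continuous f}
  | k'.+1 => (forall x, U x -> differentiable f x) /\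
             (forall v, Ck k' U ('D_v f))
  end.

Definition smooth_on (R : realType) (E F : normedModType R) (U : set E)
  (f : E -> F) : Prop := forall k, Ck k U f.

(* [chmap] and [chinv] are total functions, meaningful only on [chdom] and on
   its image respectively. *)
Record chart (R : realType) (M : topologicalType) (n : nat) := Chart {
  chdom : set M;
  chmap : M -> 'rV[R]_n;
  chinv : 'rV[R]_n -> M }.

HB.instance Definition _ (R : realType) (M : topologicalType) (n : nat) :=
  gen_eqMixin (chart R M n).
HB.instance Definition _ (R : realType) (M : topologicalType) (n : nat) :=
  gen_choiceMixin (chart R M n).

Record is_chart (R : realType) (M : topologicalType) (n : nat)
    (c : chart R M n) : Prop := IsChart {
  chart_open : open (chdom c);
  chart_open_image : open (chmap c @` chdom c);
  chart_cancel : forall u, chdom c u -> chinv c (chmap c u) = u;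
  chart_continuous : forall u, chdom c u -> {for u, continuous (chmap c)};
  chart_inv_continuous : forall p, (chmap c @` chdom c) p ->
    {for p, continuous (chinv c)} }.

Definition atlas (R : realType) (M : topologicalType) (n : nat) :=
  set (chart R M n).

Record smooth_manifold (R : realType) (M : topologicalType) (n : nat)
    (A : atlas R M n) : Prop := SmoothManifold {
  manifold_hausdorff : hausdorff_space M;
  manifold_second_countable : @second_countable M;
  manifold_charts : forall c, A c -> is_chart c;
  manifold_cover : forall u, exists2 c, A c & chdom c u;
  manifold_transition : forall c d, A c -> A d ->
    smooth_on (chmap c @` (chdom c `&` chdom d)) (chmap d \o chinv c) }.

Definition smooth_map (R : realType) (M N : topologicalType) (m n : nat)
    (A : atlas R M m) (B : atlas R N n) (f : M -> N) : Prop :=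
  continuous f /\
  forall c d, A c -> B d ->
    smooth_on (chmap c @` (chdom c `&` f @^-1` chdom d))
              (chmap d \o f \o chinv c).

Definition smooth_curve (R : realType) (N : topologicalType) (n : nat)
    (B : atlas R N n) (f : R -> N) : Prop :=
  continuous f /\
  forall d, B d -> smooth_on (f @^-1` chdom d) (chmap d \o f).

Definition prod_chart (R : realType) (M N : topologicalType) (m n : nat)
    (c : chart R M m) (d : chart R N n) : chart R (M * N)%type (m + n) :=
  Chart (chdom c `*` chdom d)
        (fun p => row_mx (chmap c p.1) (chmap d p.2))
        (fun v => (chinv c (lsubmx v), chinv d (rsubmx v))).

Definition prod_atlas (R : realType) (M N : topologicalType) (m n : nat)
    (A : atlas R M m) (B : atlas R N n) : atlas R (M * N)%type (m + n) :=
  [set e | exists c d, [/\ A c, B d & e = prod_chart c d]].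

Definition vect_atlas (R : realType) (n : nat) : atlas R 'rV[R]_n n :=
  [set Chart setT id id].

(* The tangent space T_u M is identified with R^n by means of one chart
   [chart_at A u] around u, chosen once and for all for each point u.  A tangent
   vector at u is thus a row vector, a vector field on M is a function
   [X : M -> 'rV_n] with [X u] in T_u M, and the intrinsic operations on
   tangent vectors are computed in the charts [chart_at A u].  The default value
   of [xget] is never used on a manifold. *)
Definition chart_at (R : realType) (M : topologicalType) (n : nat)
    (A : atlas R M n) (u : M) : chart R M n :=
  xget (Chart set0 (fun=> 0) (fun=> u)) [set c | A c /\ chdom c u].

Definition coord_at (R : realType) (M : topologicalType) (n : nat)
    (A : atlas R M n) (u : M) : 'rV[R]_n := chmap (chart_at A u) u.

(* Velocity at t = 0 of the curve f, a tangent vector at f 0. *)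
Definition velocity0 (R : realType) (N : topologicalType) (n : nat)
    (B : atlas R N n) (f : R -> N) : 'rV[R]_n :=
  derive1 (chmap (chart_at B (f 0)) \o f) 0.

(* The differential T_u M -> T_(f u) N of f at u. *)
Definition tangent_map (R : realType) (M N : topologicalType) (m n : nat)
    (A : atlas R M m) (B : atlas R N n) (f : M -> N) (u : M) (v : 'rV[R]_m) :
    'rV[R]_n :=
  'D_v (chmap (chart_at B (f u)) \o f \o chinv (chart_at A u)) (coord_at A u).

Definition lie_derivative (R : realType) (M : topologicalType) (m n : nat)
    (A : atlas R M m) (X : M -> 'rV[R]_m) (y : M -> 'rV[R]_n) : M -> 'rV[R]_n :=
  fun u => 'D_(X u) (y \o chinv (chart_at A u)) (coord_at A u).

(* Components of the vector field X in the chart c, as functions on R^n. *)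
Definition field_in_chart (R : realType) (M : topologicalType) (n : nat)
    (A : atlas R M n) (X : M -> 'rV[R]_n) (c : chart R M n) (p : 'rV[R]_n) :
    'rV[R]_n :=
  let u := chinv c p in
  'D_(X u) (chmap c \o chinv (chart_at A u)) (coord_at A u).

(* The Jacobi-Lie bracket: [X, Y] acts on functions as X Y - Y X. *)
Definition field_bracket (R : realType) (M : topologicalType) (n : nat)
    (A : atlas R M n) (X Y : M -> 'rV[R]_n) : M -> 'rV[R]_n :=
  fun u => let c := chart_at A u in
  'D_(X u) (field_in_chart A Y c) (coord_at A u) -
  'D_(Y u) (field_in_chart A X c) (coord_at A u).

#[short(type="groupTopologicalType")]
HB.structure Definition GroupTopological := {G of Group G & Topological G}.

Record lie_group (R : realType) (G : groupTopologicalType) (n : nat)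
    (A : atlas R G n) : Prop := LieGroup {
  lie_group_manifold : smooth_manifold A;
  lie_group_mul : smooth_map (prod_atlas A A) A (fun p : G * G => p.1 * p.2)%g;
  lie_group_inv : smooth_map A A (fun g : G => g^-1)%g }.

(* The Lie algebra of G is T_1 G, which the convention above represents as
   ['rV_n].  Its bracket is that of right-invariant vector fields
   g |-> d(h |-> h g)_1 a.  This is the convention under which x |-> lambda_* x
   is a Lie algebra morphism for left actions (left translation of G on itself
   generates the right-invariant fields); the bracket of left-invariant fields
   is the opposite one. *)
Definition right_invariant_field (R : realType) (G : groupTopologicalType)
    (n : nat) (A : atlas R G n) (a : 'rV[R]_n) : G -> 'rV[R]_n :=
  fun g => tangent_map A A (fun h : G => h * g)%g 1%g a.

Definition lie_bracket (R : realType) (G : groupTopologicalType) (n : nat)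
    (A : atlas R G n) (a b : 'rV[R]_n) : 'rV[R]_n :=
  field_bracket A (right_invariant_field A a) (right_invariant_field A b) 1%g.

(* [e] is the exponential map of G: for each a in T_1 G, t |-> e (t a) is the
   one-parameter subgroup of G with initial velocity a. *)
Record exponential_map (R : realType) (G : groupTopologicalType) (n : nat)
    (A : atlas R G n) (e : 'rV[R]_n -> G) : Prop := ExponentialMap {
  exp_smooth : forall a, smooth_curve A (fun t : R => e (t *: a));
  exp_morphism : forall a (s t : R),
    e ((s + t) *: a) = (e (s *: a) * e (t *: a))%g;
  exp_velocity : forall a, velocity0 A (fun t : R => e (t *: a)) = a }.

Record left_action (R : realType) (G : groupTopologicalType) (n : nat)
    (AG : atlas R G n) (M : topologicalType) (m : nat) (AM : atlas R M m)
    (act : G -> M -> M) : Prop := LeftAction {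
  action_smooth : smooth_map (prod_atlas AG AM) AM (fun p => act p.1 p.2);
  action_one : forall u, act 1%g u = u;
  action_mul : forall g h u, act (g * h)%g u = act g (act h u) }.

Definition Omega0 (R : realType) (M : topologicalType) (m n : nat)
    (AM : atlas R M m) : set (M -> 'rV[R]_n) :=
  [set x | smooth_map AM (@vect_atlas R n) x].
Arguments Omega0 {R M m} n AM.

Definition lambda_star (R : realType) (G : groupTopologicalType) (n : nat)
    (e : 'rV[R]_n -> G) (M : topologicalType) (m : nat) (AM : atlas R M m)
    (act : G -> M -> M) (x : M -> 'rV[R]_n) : M -> 'rV[R]_m :=
  fun u => velocity0 AM (fun t : R => act (e (t *: x u)) u).

Definition omega_bracket (R : realType) (G : groupTopologicalType) (n : nat)
    (AG : atlas R G n) (M : topologicalType) (x y : M -> 'rV[R]_n) :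
    M -> 'rV[R]_n :=
  fun u => lie_bracket AG (x u) (y u).
Arguments omega_bracket {R G n} AG {M}.

Definition omega_product (R : realType) (G : groupTopologicalType) (n : nat)
    (e : 'rV[R]_n -> G) (M : topologicalType) (m : nat) (AM : atlas R M m)
    (act : G -> M -> M) (x y : M -> 'rV[R]_n) : M -> 'rV[R]_n :=
  lie_derivative AM (lambda_star e AM act x) y.

(* Main.v *)
(* Everything is expressed through the derivative along orbits: for a vector a
   of T_1 G, L_a y (u) = d/dt y (exp (t a) u) at t = 0, which is the derivative
   in direction a of q |-> y (q u), with q in G read in a chart around 1.  By the
   chain rule (x |> y)(u) = L_(x u) y (u), and [a, b] = L_a L_b c - L_b L_a c at 1
   for G acting on itself by left translations, c being the chart.
   Differentiating y (q (p u)) = y ((q p) u) twice at the unit and using the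
   symmetry of second derivatives gives L_a L_b - L_b L_a = L_[a,b].  For G acting
   on itself this yields the Jacobi identity of the bracket.  On M, the Leibniz
   rule gives a(x, y, z)(u) = L_a L_b z (u) for the constants a = x u and b = y u,
   hence the second post-Lie axiom; the first one is the Leibniz rule for the
   bilinear bracket. *)
From HB Require Import structures.
Require Import Defs.
From mathcomp Require Import all_boot all_order all_algebra.
From mathcomp Require Import all_classical all_reals all_analysis.
From mathcomp Require Import ring lra.
Set Implicit Arguments.
Unset Strict Implicit.
Unset Printing Implicit Defensive.
Import Order.TTheory GRing.Theory Num.Theory numFieldNormedType.Exports.
Local Open Scope classical_set_scope.
Local Open Scope ring_scope.

(** * Differential calculus *)

Section derive_facts.
Context {R : realType}.
Implicit Types E F : normedModType R.

Lemma derive_comp E E' F (g : E -> E') (f : E' -> F) x v :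
  differentiable g x -> differentiable f (g x) ->
  'D_v (f \o g) x = 'D_('D_v g x) f (g x).
Proof.
move=> dg df; rewrite !deriveE//; last exact: differentiable_comp.
by rewrite diff_comp.
Qed.

Lemma derive_linear E F (f : E -> F) x a v w : differentiable f x ->
  'D_(a *: v + w) f x = a *: 'D_v f x + 'D_w f x.
Proof. by move=> df; rewrite !deriveE// linearP. Qed.

Lemma derive_dirB E F (f : E -> F) x v w : differentiable f x ->
  'D_(v - w) f x = 'D_v f x - 'D_w f x.
Proof. by move=> df; rewrite !deriveE// linearB. Qed.

(** Differentiability depends only on the germ: near [x] the first-order expansion of [f] is also
    one for [g], and by [diff_unique] its linear part is then the differential of [g]. *)
Lemma near_eq_differentiable E F (f g : E -> F) x :
  (\near x, f x = g x) -> differentiable f x -> differentiable g x.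
Proof.
move=> fg df; have [dfc /eqaddoP dfo] := (diff_locallyP _ _).1 df.
have go : g \o shift x = cst (g x) + 'd f x +o_0 id.
  have fg0 : \forall z \near 0, f (z + x) = g (z + x).
    have := near_shift 0 x (fun y => f y = g y); rewrite /= subr0 => <-.
    exact: fg.
  apply/eqaddoP => e e0; apply: filterS2 fg0 (dfo _ e0) => y /= fgy.
  by rewrite !fctE /= fgy (nbhs_singleton fg).
by apply/diff_locallyP; rewrite (diff_unique dfc go).
Qed.

Lemma scale_is_bilinear F : bilinear_for
    (GRing.Scale.Law.clone _ _ *:%R _) (GRing.Scale.Law.clone _ _ *:%R _)
    ( *:%R : R -> F -> F).
Proof.
split=> [u'|u] a x y /=; first by rewrite scalerDl scalerA.
by rewrite scalerDr !scalerA mulrC.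
Qed.

(** Scaling is a continuous bilinear map, so the chain rule applies to its composite with the pair
    of [h] and [f]. *)
Lemma is_diff_scale E F (h : E -> R) (f : E -> F) x :
  differentiable h x -> differentiable f x ->
  is_diff x (fun x => h x *: f x) (fun v => h x *: 'd f x v + 'd h x v *: f x).
Proof.
move=> dh df.
pose B := bilinear_isBilinear.Build R R F F _ _ _ (@scale_is_bilinear F).
pose b : {bilinear R -> F -> F} := HB.pack ( *:%R : R -> F -> F) B.
have bc : continuous (fun p : R * F => b p.1 p.2) := @scale_continuous R F.
have -> : (fun x => h x *: f x) =
    (fun p : R * F => b p.1 p.2) \o (fun y => (h y, f y)) by [].
have dp := differentiable_pair dh df.
split; first by apply: differentiable_comp => //; exact: differentiable_bilin.
by rewrite diff_comp//; [rewrite diff_bilin// diff_pair|exact: differentiable_bilin].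
Qed.

Lemma differentiable_scale E F (h : E -> R) (f : E -> F) x :
  differentiable h x -> differentiable f x ->
  differentiable (fun x => h x *: f x) x.
Proof. by move=> dh df; have [] := is_diff_scale dh df. Qed.

Lemma derive_scale E F (h : E -> R) (f : E -> F) x v :
  differentiable h x -> differentiable f x ->
  'D_v (fun x => h x *: f x) x = h x *: 'D_v f x + 'D_v h x *: f x.
Proof.
move=> dh df; have [d dE] := is_diff_scale dh df.
by rewrite !deriveE// dE.
Qed.

Lemma derivative_linear E F (f : {linear E -> F}) x v :
  continuous f -> 'D_v f x = f v.
Proof.
by move=> cf; rewrite deriveE; [rewrite diff_lin|exact: linear_differentiable].
Qed.

End derive_facts.

(** * Maps of class C^k: locality, sums, products, composition *)

Section Ck_facts.
Context {R : realType}.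
Implicit Types E F : normedModType R.

Lemma Ck_sub k E F (U V : set E) (f : E -> F) : U `<=` V ->
  Ck k V f -> Ck k U f.
Proof.
by elim: k f => [|k IH] f UV /=; [move=> + x /UV; apply|
  move=> [df Df]; split=> [x /UV/df//|v]; apply: IH].
Qed.

(** [Ck] imposes its conditions at the points of [U] one at a time, so [Ck k [set x]] serves as
    being of class C^k at [x]. *)
Lemma Ck_local k E F (U : set E) (f : E -> F) :
  (forall x, U x -> Ck k [set x] f) -> Ck k U f.
Proof.
elim: k f => [|k IH] f /=; first by move=> Uf x /Uf; apply.
move=> Uf; split=> [x /Uf[+ _]|v]; first exact.
by apply: IH => x /Uf[].
Qed.

(** Functions equal near [x] are also equal near each point close to [x], so their directional
    derivatives agree near [x] and the induction goes on. *)
Lemma Ck_near k E F x (f g : E -> F) :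
  (\near x, f x = g x) -> Ck k [set x] f -> Ck k [set x] g.
Proof.
elim: k f g => [|k IH] f g fg /=.
  move=> cf _ ->; have := cf _ erefl; rewrite /prop_for /continuous_at.
  by rewrite -(nbhs_singleton fg) => /(cvg_trans _); apply; apply: near_eq_cvg.
move=> [df Df]; split=> [_ ->|v]; first exact: near_eq_differentiable (df _ _).
apply: IH (Df v); near=> y; apply: near_eq_derive; near: y.
exact: near_join.
Unshelve. all: by end_near. Qed.

Lemma Ck_eq k E F (U : set E) (f g : E -> F) : open U ->
  {in U, f =1 g} -> Ck k U f -> Ck k U g.
Proof.
move=> oU fg fk; apply: Ck_local => x Ux; apply: (@Ck_near _ _ _ _ f).
  by apply: filterS (open_nbhs_nbhs (conj oU Ux)) => y Uy; apply/fg/mem_set.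
by apply: Ck_sub fk => _ ->.
Qed.

Lemma Ck_le k E F (U : set E) (f : E -> F) : Ck k.+1 U f -> Ck k U f.
Proof.
elim: k f => [|k IH] f [df Df] /=.
  by move=> x /df; exact: differentiable_continuous.
by split=> // v; apply: IH; exact: Df.
Qed.

Lemma Ck_cst k E F (U : set E) (a : F) : Ck k U (fun=> a : F).
Proof.
elim: k a => [|k IH] a /=; first by move=> x _; exact: cst_continuous.
split=> [x _|v]; first exact: differentiable_cst.
by rewrite (_ : 'D_v _ = fun=> 0)//; apply/funext => x; exact: derive_cst.
Qed.

Lemma Ck_linear k E F (U : set E) (f : {linear E -> F}) :
  continuous f -> Ck k U f.
Proof.
case: k => [|k] cf /=; first by move=> x _; exact: cf.
split=> [x _|v]; first exact: linear_differentiable.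
rewrite (_ : 'D_v _ = fun=> f v); first exact: Ck_cst.
by apply/funext => x; exact: derivative_linear.
Qed.

Lemma CkD k E F (U : set E) (f g : E -> F) : open U ->
  Ck k U f -> Ck k U g -> Ck k U (f + g).
Proof.
move=> oU; elim: k f g => [|k IH] f g /=.
  by move=> cf cg x Ux; apply: continuousD; [apply: cf|apply: cg].
move=> [df Df] [dg Dg]; split=> [x Ux|v].
  by apply: differentiableD; [apply: df|apply: dg].
apply: Ck_eq (IH _ _ (Df v) (Dg v)) => // x /set_mem Ux.
by rewrite deriveD//; apply: diff_derivable; [apply: df|apply: dg].
Qed.

Lemma Ck_sum k E F (U : set E) n (f : 'I_n -> E -> F) : open U ->
  (forall i, Ck k U (f i)) -> Ck k U (fun x => \sum_(i < n) f i x).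
Proof.
move=> oU fk; rewrite (_ : (fun x => _) = \sum_(i < n) f i); last first.
  by apply/funext => x; rewrite fct_sumE.
apply: (big_ind (Ck k U)) => //; first exact: Ck_cst.
by move=> *; exact: CkD.
Qed.

Lemma Ck_scale k E F (U : set E) (h : E -> R) (f : E -> F) : open U ->
  Ck k U h -> Ck k U f -> Ck k U (fun x => h x *: f x).
Proof.
move=> oU; elim: k h f => [|k IH] h f hk fk.
  move=> x Ux; apply: cvgZ; [exact: hk|exact: fk].
have [dh Dh] := hk; have [df Df] := fk; split=> [x Ux|v].
  by apply: differentiable_scale; [apply: dh|apply: df].
(* Leibniz rule: the induction hypothesis wants both factors at order [k], so [Ck_le] lowers the
   order of the factor that is not differentiated. *)
apply: Ck_eq (CkD oU (IH _ _ (Ck_le hk) (Df v)) (IH _ _ (Dh v) (Ck_le fk))) => //.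
by move=> x /set_mem Ux; rewrite derive_scale//; [exact: dh|exact: df].
Qed.

Lemma Ck_linear_comp k E F F' (U : set E) (f : E -> F) (l : {linear F -> F'}) :
  open U -> continuous l -> Ck k U f -> Ck k U (l \o f).
Proof.
move=> oU cl; elim: k f => [|k IH] f /=.
  by move=> cf x Ux; apply: continuous_comp; [exact: cf|exact: cl].
move=> [df Df]; have dl y : differentiable l y by exact: linear_differentiable.
split=> [x Ux|v]; first by apply: differentiable_comp => //; exact: df.
apply: Ck_eq (IH _ (Df v)) => // x /set_mem Ux.
by rewrite derive_comp//; [rewrite derivative_linear|exact: df].
Qed.

(** A named function, so that it can carry the linear structure declared below. *)
Definition coord_mx n (i : 'I_n) (u : 'rV[R]_n) : R := u 0 i.

Lemma coord_mx_is_linear n (i : 'I_n) : linear (coord_mx i : 'rV[R]_n -> R).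
Proof. by move=> a u v; rewrite /coord_mx !mxE. Qed.
HB.instance Definition _ n (i : 'I_n) :=
  GRing.isLinear.Build R 'rV[R]_n R *:%R (coord_mx i) (coord_mx_is_linear i).

Lemma coord_mx_continuous n (i : 'I_n) : continuous (coord_mx i).
Proof. exact: coord_continuous. Qed.

Lemma derive_rowE n F (f : 'rV[R]_n -> F) x v : differentiable f x ->
  'D_v f x = \sum_(i < n) v 0 i *: 'D_(delta_mx 0 i) f x.
Proof.
move=> df; rewrite deriveE// {1}(row_sum_delta v) linear_sum.
by apply: eq_bigr => i _; rewrite linearZ/= deriveE.
Qed.

Lemma derive_coord n E (f : E -> 'rV[R]_n) x v i : differentiable f x ->
  ('D_v f x) 0 i = 'D_v (fun y => f y 0 i) x.
Proof.
move=> df; transitivity ('D_v (coord_mx i \o f) x) => //.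
rewrite [RHS](derive_comp _ df); last first.
  by apply: linear_differentiable; exact: coord_mx_continuous.
by rewrite derivative_linear//; exact: coord_mx_continuous.
Qed.

Lemma Ck_coord k E n (U : set E) (f : E -> 'rV[R]_n) i : open U ->
  Ck k U f -> Ck k U (fun x => f x 0 i).
Proof.
by move=> oU; exact: (Ck_linear_comp oU (@coord_mx_continuous n i)).
Qed.

(** In the chain rule the direction ['D_v g x] moves with [x], whereas [Ck] speaks of fixed
    directions only. Expanding it in the standard basis of ['rV_n] leaves a sum of products covered
    by the induction hypothesis and [Ck_scale]. *)
Lemma Ck_comp k E F n (U : set E) (V : set 'rV[R]_n) (g : E -> 'rV[R]_n)
    (f : 'rV[R]_n -> F) : open U -> g @` U `<=` V ->
  Ck k U g -> Ck k V f -> Ck k U (f \o g).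
Proof.
move=> oU gUV; elim: k f => [|k IH] f gk fk.
  move=> x Ux; apply: continuous_comp; first exact: gk.
  by apply: fk; apply: gUV; exists x.
have [dg Dg] := gk; have [df Df] := fk.
have dfg x : U x -> differentiable f (g x) by move=> Ux; apply/df/gUV; exists x.
split=> [x Ux|v]; first by apply: differentiable_comp; [exact: dg|exact: dfg].
suff H : Ck k U
    (fun x => \sum_(i < n) 'D_v g x 0 i *: ('D_(delta_mx 0 i) f \o g) x).
  apply: Ck_eq H => // x /set_mem Ux.
  by rewrite (derive_comp _ (dg _ Ux) (dfg _ Ux)) derive_rowE//; exact: dfg.
apply: Ck_sum => // i; apply: Ck_scale => //; first exact: (Ck_coord _ oU (Dg v)).
by apply: IH; [exact: Ck_le|exact: Df].
Qed.

End Ck_facts.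

(** * Symmetry of second derivatives *)

Section schwarz.
Context {R : realType}.
Implicit Types E : normedModType R.

Lemma is_derive_line E (F : normedModType R) (f : E -> F) p v t :
  differentiable f (p + t *: v) ->
  is_derive t 1 (fun s : R => f (p + s *: v)) ('D_v f (p + t *: v)).
Proof.
move=> df; pose l (s : R) := p + s *: v.
have dl : is_diff t l ( *:%R ^~ v).
  by apply: is_diff_eq; apply/funext => s; rewrite fctE add0r.
have dfl : differentiable (f \o l) t by apply: differentiable_comp.
apply: DeriveDef; first exact: diff_derivable.
have [ddl dlE] := dl.
by rewrite [LHS](derive_comp _ ddl df) (deriveE _ ddl) dlE/= scale1r.
Qed.

Lemma MVT_line E (f : E -> R) p v h : 0 < h ->
  (forall t, 0 <= t <= h -> differentiable f (p + t *: v)) ->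
  exists2 t, 0 < t < h & f (p + h *: v) - f p = h * 'D_v f (p + t *: v).
Proof.
move=> h0 df.
have [||t] := @MVT R (fun s => f (p + s *: v)) (fun t => 'D_v f (p + t *: v)) 0 h h0.
- move=> t; rewrite in_itv/= => /andP[t0 th].
  by apply: is_derive_line; apply: df; rewrite !ltW.
- apply: continuous_in_subspaceT => t /set_mem/=; rewrite in_itv/= => th.
  apply: differentiable_continuous; apply/derivable1_diffP.
  by have [] := is_derive_line (df _ th).
rewrite in_itv/= => th E0; exists t => //.
by rewrite mulrC -[X in 'D_v f _ * X]subr0 -E0 scale0r addr0.
Qed.

Lemma derive_translate E (F : normedModType R) (f : E -> F) c x v :
  'D_v (fun y => f (y + c)) x = 'D_v f (x + c).
Proof.
rewrite /derive; congr (lim _); apply: (congr1 (fun g => g @ 0^')).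
by apply/funext => h; rewrite /= addrA.
Qed.

Lemma differentiable_translate E (F : normedModType R) (f : E -> F) c x :
  differentiable f (x + c) -> differentiable (fun y => f (y + c)) x.
Proof.
by move=> df; apply: (@differentiable_comp _ _ _ _ (fun y => y + c)).
Qed.

(* Exchanging v and w leaves the left-hand side unchanged, which is how the
   symmetry of second derivatives arises. *)
Lemma second_difference E (U : set E) (f : E -> R) x v w h : 0 < h ->
  Ck 2 U f ->
  (forall s t, 0 <= s <= h -> 0 <= t <= h -> U (x + s *: v + t *: w)) ->
  exists s t, [/\ 0 <= s <= h, 0 <= t <= h &
    f (x + h *: v + h *: w) - f (x + h *: v) - (f (x + h *: w) - f x) =
    h * (h * 'D_w ('D_v f) (x + s *: v + t *: w))].
Proof.
move=> h0 [df Df] Uxh; have hh : 0 <= h <= h by rewrite ltW/=.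
have h00 : 0 <= (0 : R) <= h by rewrite lexx ltW.
have dg t : 0 <= t <= h -> let y := x + t *: v in
    differentiable f y /\ differentiable f (y + h *: w).
  move=> th y; split; last exact/df/Uxh.
  by have := Uxh _ _ th h00; rewrite scale0r addr0 => /df.
(* The mean value theorem is applied to this increment along [v], and then to ['D_v f] along [w]. *)
pose g y := f (y + h *: w) - f y.
have [|s sh] := @MVT_line E g x v h h0.
  move=> t /dg[d1 d2]; apply: differentiableB => //.
  exact: differentiable_translate.
have sh' : 0 <= s <= h by case/andP: sh => *; rewrite !ltW.
have [d1 d2] := dg _ sh'.
have -> : 'D_v g (x + s *: v) =
    'D_v f (x + s *: v + h *: w) - 'D_v f (x + s *: v).
  rewrite deriveB ?derive_translate//; apply: diff_derivable => //.
  exact: differentiable_translate.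
have [Dvf DDf] := Df v.
have [|t th ->] := @MVT_line E ('D_v f) (x + s *: v) w h h0.
  by move=> t th; apply/Dvf/Uxh.
move=> Es; exists s, t; split => //.
by case/andP: th => t0 t1; rewrite !ltW.
Qed.

Lemma ler_distl_half (a b c e : R) :
  `|b - c| < e / 2 -> `|a - c| < e / 2 -> `|a - b| <= e.
Proof.
rewrite !ltr_distl ler_distl => /andP[? ?] /andP[? ?].
by apply/andP; split; lra.
Qed.

(** The second difference over a small parallelogram is [h * h] times either mixed derivative, each
    taken at some point of the parallelogram. By continuity both are within [e / 2] of their values
    at [x], for every positive [e]. *)
Lemma schwarz_real E (U : set E) (f : E -> R) x v w : open U -> U x ->
  Ck 2 U f -> 'D_v ('D_w f) x = 'D_w ('D_v f) x.
Proof.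
move=> oU Ux f2; have [df Df] := f2.
have cvw v1 v2 : {for x, continuous ('D_v1 ('D_v2 f))}.
  by have [_ DDf] := Df v2; exact: DDf.
apply/eqP; rewrite -subr_eq0 -normr_le0; apply/ler_addgt0Pr => e e0.
rewrite add0r.
have e20 : 0 < e / 2 by rewrite divr_gt0.
have : \forall y \near x, [/\ U y,
    `|'D_v ('D_w f) x - 'D_v ('D_w f) y| < e / 2 &
    `|'D_w ('D_v f) x - 'D_w ('D_v f) y| < e / 2].
  have /cvgrPdist_lt/(_ _ e20) cv := cvw v w.
  have /cvgrPdist_lt/(_ _ e20) cw := cvw w v.
  apply: filterS3 (open_nbhs_nbhs (conj oU Ux)) cv cw => y; exact: And3.
move=> /nbhs_ballP[d /= d0 xd].
(* Points of the parallelogram are at distance at most [h * c], that is [d / 2], from [x]. The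
   summand 1 keeps [c] positive even if [v] and [w] vanish. *)
pose c := `|v| + `|w| + 1; have c0 : 0 < c by rewrite ltr_wpDl// addr_ge0.
pose h := d / c / 2; have h0 : 0 < h by rewrite !divr_gt0.
have hd s t : 0 <= s <= h -> 0 <= t <= h -> ball x d (x + s *: v + t *: w).
  move=> /andP[s0 sh] /andP[t0 th]; rewrite -ball_normE/= -addrA opprD addNKr normrN.
  apply: (@le_lt_trans _ _ (h * c)); last first.
    by rewrite /h mulrAC divfK ?gt_eqF// ltr_pdivrMr// ltr_pMr// ltr1n.
  apply: le_trans (ler_normD _ _) _; rewrite !normrZ !ger0_norm//.
  by rewrite /c !mulrDr -[leLHS]addr0 !lerD ?ler_wpM2r// mulr1 ltW.
have [s [t [sh th E1]]] := second_difference h0 f2 (fun s t sh th =>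
  let: And3 H _ _ := xd _ (hd s t sh th) in H).
(* The same second difference with [v] and [w] exchanged; [addrAC] reorders the vertices to
   match. *)
have [s' [t' [sh' th' E2]]] := @second_difference E U f x w v h h0 f2
  (fun s t sh th =>
  let: And3 H _ _ := xd _ (eq_ind _ (ball x d) (hd t s th sh) _ (addrAC _ _ _)) in H).
have [_ _ B1] := xd _ (hd _ _ sh th).
have [_ B2 _] := xd _ (hd _ _ th' sh').
have E12 : 'D_w ('D_v f) (x + s *: v + t *: w) = 'D_v ('D_w f) (x + t' *: v + s' *: w).
  have hN : h != 0 by rewrite gt_eqF.
  rewrite (addrAC x (t' *: v)); move: E1 E2; rewrite (addrAC x (h *: w)).
  move: (f _) (f _) (f _) (f _) ('D_w _ _) ('D_v _ _) => a1 a2 a3 a4 b1 b2 E1 E2.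
  apply: (mulfI hN); apply: (mulfI hN); rewrite -E1 -E2.
  ring.
rewrite E12 in B1.
exact: ler_distl_half B1 B2.
Qed.

(** The mean value theorem concerns real functions, so the symmetry is transferred one coordinate at
    a time. *)
Lemma schwarz E n (U : set E) (f : E -> 'rV[R]_n) x v w : open U -> U x ->
  Ck 2 U f -> 'D_v ('D_w f) x = 'D_w ('D_v f) x.
Proof.
move=> oU Ux f2; have [df Df] := f2; apply/rowP => i.
have D v1 v2 : ('D_v1 ('D_v2 f) x) 0 i = 'D_v1 ('D_v2 (fun y => f y 0 i)) x.
  rewrite derive_coord; last by have [+ _] := Df v2; apply.
  apply: near_eq_derive; apply: filterS (open_nbhs_nbhs (conj oU Ux)) => y Uy.
  by rewrite derive_coord//; exact: df.
have S := schwarz_real v w oU Ux (Ck_coord i oU f2).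
exact: etrans (D v w) (etrans S (esym (D w v))).
Qed.

End schwarz.

(** * Smoothness at a point *)

Section smooth_at.
Context {R : realType}.
Implicit Types E F : normedModType R.

(** A single neighbourhood serves all orders, so that smoothness at [x] spreads to nearby points;
    C^k at [x] for every [k] would allow neighbourhoods shrinking with [k]. *)
Definition smooth_at E F (f : E -> F) (x : E) :=
  exists U : set E, [/\ open U, U x & smooth_on U f].

Lemma smooth_on_at E F (U : set E) (f : E -> F) x :
  open U -> U x -> smooth_on U f -> smooth_at f x.
Proof. by exists U. Qed.

Lemma smooth_at_on E F (U : set E) (f : E -> F) :
  (forall x, U x -> smooth_at f x) -> smooth_on U f.
Proof.
move=> Uf k; apply: Ck_local => x /Uf[V [_ Vx fV]].
by apply: Ck_sub (fV k) => _ ->.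
Qed.

Lemma smooth_at_near E F (f : E -> F) x :
  smooth_at f x -> \near x, smooth_at f x.
Proof.
move=> [U [oU Ux fU]]; apply: filterS (open_nbhs_nbhs (conj oU Ux)) => y Uy.
exact: smooth_on_at fU.
Qed.

Lemma smooth_at_eq E F (f g : E -> F) x :
  (\near x, f x = g x) -> smooth_at f x -> smooth_at g x.
Proof.
move=> fg [U [oU Ux fU]].
exists (U `&` (fun y => f y = g y)^°); split.
- by apply: openI => //; exact: open_interior.
- by split.
- move=> k; apply: Ck_local => y [Uy fgy]; apply: Ck_near fgy _.
  by apply: Ck_sub (fU k) => _ ->.
Qed.

Lemma smooth_at_differentiable E F (f : E -> F) x :
  smooth_at f x -> differentiable f x.
Proof. by move=> [U [_ Ux /(_ 1%N)[df _]]]; exact: df. Qed.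

Lemma smooth_at_continuous E F (f : E -> F) x :
  smooth_at f x -> {for x, continuous f}.
Proof. by move=> /smooth_at_differentiable/differentiable_continuous. Qed.

Lemma smooth_at_derive E F (f : E -> F) x v :
  smooth_at f x -> smooth_at ('D_v f) x.
Proof.
by move=> [U [oU Ux fU]]; exists U; split => // k; have [_] := fU k.+1; exact.
Qed.

Lemma smooth_at_linear E F (f : {linear E -> F}) x :
  continuous f -> smooth_at f x.
Proof.
by move=> cf; exists setT; split => [||k]; [exact: openT| |exact: Ck_linear].
Qed.

Lemma smooth_at_cst E F (a : F) x : smooth_at (fun=> a : F) (x : E).
Proof.
by exists setT; split => [||k]; [exact: openT| |exact: Ck_cst].
Qed.

Lemma smooth_atD E F (f g : E -> F) x :
  smooth_at f x -> smooth_at g x -> smooth_at (f + g) x.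
Proof.
move=> [U [oU Ux fU]] [V [oV Vx gV]]; have oUV := openI oU oV.
exists (U `&` V); split => // k; apply: CkD => //.
- by apply: Ck_sub (fU k) => y [].
- by apply: Ck_sub (gV k) => y [].
Qed.

Lemma smooth_at_scale E F (h : E -> R) (f : E -> F) x :
  smooth_at h x -> smooth_at f x -> smooth_at (fun x => h x *: f x) x.
Proof.
move=> [U [oU Ux hU]] [V [oV Vx fV]]; have oUV := openI oU oV.
exists (U `&` V); split => // k; apply: Ck_scale => //.
- by apply: Ck_sub (hU k) => y [].
- by apply: Ck_sub (fV k) => y [].
Qed.

Lemma smooth_atZ E F (a : R) (f : E -> F) x :
  smooth_at f x -> smooth_at (a *: f) x.
Proof. by apply: smooth_at_scale; exact: smooth_at_cst. Qed.

Lemma smooth_at_sum E F n (f : 'I_n -> E -> F) x :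
  (forall i, smooth_at (f i) x) -> smooth_at (fun x => \sum_(i < n) f i x) x.
Proof.
move=> sf; rewrite (_ : (fun x => _) = \sum_(i < n) f i); last first.
  by apply/funext => y; rewrite fct_sumE.
apply: (big_ind (fun f => smooth_at f x)) => //; first exact: smooth_at_cst.
by move=> *; exact: smooth_atD.
Qed.

Lemma smooth_at_coord E n (f : E -> 'rV[R]_n) i x :
  smooth_at f x -> smooth_at (fun x => f x 0 i) x.
Proof.
by move=> [U [oU Ux fU]]; exists U; split => // k; exact: Ck_coord.
Qed.

Lemma smooth_at_comp E F n (g : E -> 'rV[R]_n) (f : 'rV[R]_n -> F) x :
  smooth_at g x -> smooth_at f (g x) -> smooth_at (f \o g) x.
Proof.
move=> sg [V [oV Vx fV]]; have [U [oU Ux gU]] := sg.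
(* The preimage of [V] need not be open, as [g] is known to be continuous only on [U]; hence the
   interior. *)
pose W := U `&` (g @^-1` V)^°.
have oW : open W by apply: openI => //; exact: open_interior.
exists W; split => //.
  split=> //; apply: (smooth_at_continuous sg).
  by apply: open_nbhs_nbhs.
move=> k; apply: Ck_comp (fV k) => //.
  by move=> _ [y [_ /interior_subset yV] <-].
by apply: Ck_sub (gU k) => y [].
Qed.

Lemma schwarz_at E n (f : E -> 'rV[R]_n) x v w :
  smooth_at f x -> 'D_v ('D_w f) x = 'D_w ('D_v f) x.
Proof. by move=> [U [oU Ux fU]]; exact: (schwarz v w oU Ux (fU 2)). Qed.

End smooth_at.

(** * Row vectors, moving directions and bilinear maps *)

Section row_facts.
Context {R : realType}.
Implicit Types E F : normedModType R.

Lemma smooth_at_row E n (f : E -> 'rV[R]_n) x :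
  (forall i, smooth_at (fun y => f y 0 i) x) -> smooth_at f x.
Proof.
move=> sf; rewrite (_ : f = fun y => \sum_(i < n) f y 0 i *: delta_mx 0 i).
  by apply: smooth_at_sum => i; apply: smooth_at_scale => //; exact: smooth_at_cst.
by apply/funext => y; exact: row_sum_delta.
Qed.

Lemma smooth_at_row_mx E n1 n2 (f : E -> 'rV[R]_n1) (g : E -> 'rV[R]_n2) x :
  smooth_at f x -> smooth_at g x -> smooth_at (fun y => row_mx (f y) (g y)) x.
Proof.
move=> sf sg; apply: smooth_at_row => i; rewrite -(splitK i).
case: (fintype.split i) => j /=.
  rewrite (_ : (fun y => _) = fun y => f y 0 j); first exact: smooth_at_coord.
  by apply/funext => y; rewrite row_mxEl.
rewrite (_ : (fun y => _) = fun y => g y 0 j); first exact: smooth_at_coord.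
by apply/funext => y; rewrite row_mxEr.
Qed.

Lemma smooth_at_id n (x : 'rV[R]_n) : smooth_at id x.
Proof. by apply: (@smooth_at_linear _ _ _ idfun) => y. Qed.

(** Both sides have the same difference quotients. This turns a partial derivative into a derivative
    in a fixed direction of the joint map, which keeps it smooth in the other variable. *)
Lemma derive_row_mxl n1 n2 F (f : 'rV[R]_(n1 + n2) -> F) p q v :
  'D_v (fun x => f (row_mx x q)) p = 'D_(row_mx v 0) f (row_mx p q).
Proof.
rewrite /derive; congr (lim _); apply: (congr1 (fun g => g @ 0^')).
by apply/funext => h; rewrite /= scale_row_mx add_row_mx scaler0 add0r.
Qed.

Lemma linear_sum_delta n F (f : 'rV[R]_n -> F) v : linear f ->
  f v = \sum_(i < n) v 0 i *: f (delta_mx 0 i).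
Proof.
move=> lf; pose B := GRing.isLinear.Build R 'rV[R]_n F *:%R f lf.
pose l : {linear 'rV[R]_n -> F} := HB.pack f B.
rewrite -[f]/(l : _ -> _) {1}(row_sum_delta v) linear_sum.
by apply: eq_bigr => i _; rewrite linearZ.
Qed.

Lemma linear_row_continuous n F (f : {linear 'rV[R]_n -> F}) : continuous f.
Proof.
move=> x; rewrite (_ : (f : _ -> _) = fun v => \sum_(i < n) v 0 i *: f (delta_mx 0 i)).
  apply: smooth_at_continuous; apply: smooth_at_sum => i.
  apply: smooth_at_scale; last exact: smooth_at_cst.
  by apply: smooth_at_coord; exact: smooth_at_id.
by apply/funext => v; apply: linear_sum_delta => a u w; rewrite linearP.
Qed.

Lemma derive_sum_at E F n (f : 'I_n -> E -> F) x v :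
  (forall i, differentiable (f i) x) ->
  'D_v (fun y => \sum_(i < n) f i y) x = \sum_(i < n) 'D_v (f i) x.
Proof.
move=> df; rewrite -derive_sum => [|i]; last exact: diff_derivable.
by congr ('D_v _ x); apply/funext => y; rewrite fct_sumE.
Qed.

Lemma derive_scale_sum E F n (h : 'I_n -> E -> R) (f : 'I_n -> E -> F) x v :
  (forall i, differentiable (h i) x) -> (forall i, differentiable (f i) x) ->
  'D_v (fun y => \sum_(i < n) h i y *: f i y) x =
  \sum_(i < n) h i x *: 'D_v (f i) x + \sum_(i < n) 'D_v (h i) x *: f i x.
Proof.
move=> dh df; rewrite derive_sum_at => [|i]; last exact: differentiable_scale.
by rewrite -big_split; apply: eq_bigr => i _; rewrite derive_scale.
Qed.

(** Leibniz rule for differentiation along a moving direction: one term with the direction frozen at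
    [r x], one with the derivative of the direction. *)
Lemma derive_field n F (r : 'rV[R]_n -> 'rV[R]_n) (f : 'rV[R]_n -> F) x v :
  smooth_at r x -> smooth_at f x ->
  'D_v (fun y => 'D_(r y) f y) x = 'D_v ('D_(r x) f) x + 'D_('D_v r x) f x.
Proof.
move=> sr sf; have dDf w : differentiable ('D_w f) x.
  exact/smooth_at_differentiable/smooth_at_derive.
(* Stated for any smooth direction so as to serve both for [r] and for the constant [r x], where the
   second sum vanishes. *)
have E u : smooth_at u x -> 'D_v (fun y => 'D_(u y) f y) x =
   \sum_(i < n) u x 0 i *: 'D_v ('D_(delta_mx 0 i) f) x +
   \sum_(i < n) 'D_v (fun y => u y 0 i) x *: 'D_(delta_mx 0 i) f x.
  move=> su; rewrite -derive_scale_sum//; last first.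
    by move=> i; exact/smooth_at_differentiable/smooth_at_coord.
  apply: near_eq_derive; apply: filterS (smooth_at_near sf) => y.
  by move=> /smooth_at_differentiable/derive_rowE ->.
rewrite E// [X in _ = X + _](E (fun=> r x)); last exact: smooth_at_cst.
rewrite [X in _ = _ + X + _]big1 => [|i _]; last by rewrite derive_cst scale0r.
rewrite addr0; congr (_ + _); rewrite derive_rowE; last exact: smooth_at_differentiable.
apply: eq_bigr => i _; rewrite derive_coord//; exact: smooth_at_differentiable.
Qed.

Section bilinear.
Variables (n1 n2 : nat) (F : normedModType R) (b : 'rV[R]_n1 -> 'rV[R]_n2 -> F).
Hypotheses (linl : forall y, linear (b^~ y)) (linr : forall x, linear (b x)).

Let lin x : {linear 'rV[R]_n2 -> F} :=
  HB.pack (b x) (GRing.isLinear.Build R 'rV[R]_n2 F *:%R (b x) (linr x)).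

Let dlin x y : differentiable (b x) y.
Proof.
have := @linear_differentiable _ _ _ (lin x) y; apply.
exact: linear_row_continuous.
Qed.

Let derive_lin x y v : 'D_v (b x) y = b x v.
Proof.
have := @derivative_linear _ _ _ (lin x) y v; apply.
exact: linear_row_continuous.
Qed.

Let slin x y : smooth_at (b x) y.
Proof.
have := @smooth_at_linear _ _ _ (lin x) y; apply.
exact: linear_row_continuous.
Qed.

(** Expanding the first argument in the standard basis reduces [b] to products of a real function
    with a linear image of [g]. *)
Lemma smooth_at_bilinear E (f : E -> 'rV[R]_n1) (g : E -> 'rV[R]_n2) x :
  smooth_at f x -> smooth_at g x -> smooth_at (fun y => b (f y) (g y)) x.
Proof.
move=> sf sg; rewrite (_ : (fun y => _) =
    fun y => \sum_(i < n1) f y 0 i *: b (delta_mx 0 i) (g y)).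
  apply: smooth_at_sum => i; apply: smooth_at_scale; first exact: smooth_at_coord.
  exact: (smooth_at_comp sg).
by apply/funext => y; exact: (linear_sum_delta (f y) (linl (g y))).
Qed.

Lemma derive_bilinear E (f : E -> 'rV[R]_n1) (g : E -> 'rV[R]_n2) x v :
  smooth_at f x -> smooth_at g x ->
  'D_v (fun y => b (f y) (g y)) x = b ('D_v f x) (g x) + b (f x) ('D_v g x).
Proof.
move=> sf sg; have df := smooth_at_differentiable sf.
have dg := smooth_at_differentiable sg.
rewrite (_ : (fun y => _) =
    fun y => \sum_(i < n1) f y 0 i *: b (delta_mx 0 i) (g y)); last first.
  by apply/funext => y; exact: (linear_sum_delta (f y) (linl (g y))).
have dbg i : differentiable (b (delta_mx 0 i) \o g) x by exact: differentiable_comp.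
rewrite derive_scale_sum// => [|i]; last first.
  exact/smooth_at_differentiable/smooth_at_coord.
rewrite addrC (linear_sum_delta _ (linl (g x))) (linear_sum_delta (f x) (linl _)).
congr (_ + _); apply: eq_bigr => i _; first by rewrite derive_coord.
by rewrite [X in _ *: X](derive_comp _ dg)// derive_lin.
Qed.

End bilinear.

End row_facts.

(** * Charts *)

Section charts.
Context {R : realType}.

(* The part of [is_chart] at a single point that composition needs; unlike the
   global condition it passes easily to product charts. *)
Record chart_near (M : topologicalType) m (c : chart R M m) (u : M) : Prop :=
  ChartNear {
    near_cancel : chinv c (chmap c u) = u;
    near_inv_continuous : {for chmap c u, continuous (chinv c)};
    near_image : \forall p \near chmap c u,
      chdom c (chinv c p) /\ chmap c (chinv c p) = p }.

Lemma is_chart_near (M : topologicalType) m (c : chart R M m) u :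
  is_chart c -> chdom c u -> chart_near c u.
Proof.
move=> hc cu; have im : (chmap c @` chdom c) (chmap c u) by exists u.
split; first exact: chart_cancel.
  exact: chart_inv_continuous.
apply: filterS (open_nbhs_nbhs (conj (chart_open_image hc) im)) => _ [w cw <-].
by rewrite (chart_cancel hc cw).
Qed.

Lemma prod_chart_near (M N : topologicalType) m n (c : chart R M m)
    (d : chart R N n) u w : chart_near c u -> chart_near d w ->
  chart_near (prod_chart c d) (u, w).
Proof.
move=> cu dw; have [cK cc cn] := cu; have [dK dc dn] := dw.
have lc : lsubmx v @[v --> row_mx (chmap c u) (chmap d w)] --> chmap c u.
  by rewrite -[X in _ --> X](row_mxKl _ (chmap d w)); exact: continuous_lsubmx.
have rc : rsubmx v @[v --> row_mx (chmap c u) (chmap d w)] --> chmap d w.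
  by rewrite -[X in _ --> X](row_mxKr (chmap c u)); exact: continuous_rsubmx.
split=> /=.
- by rewrite row_mxKl row_mxKr cK dK.
- rewrite /prop_for /continuous_at /= row_mxKl row_mxKr.
  exact: cvg_pair (cvg_comp _ _ lc cc) (cvg_comp _ _ rc dc).
- pose v0 := row_mx (chmap c u) (chmap d w).
  have ln : \forall v \near v0, chdom c (chinv c (lsubmx v)) /\
    chmap c (chinv c (lsubmx v)) = lsubmx v := lc _ cn.
  have rn : \forall v \near v0, chdom d (chinv d (rsubmx v)) /\
    chmap d (chinv d (rsubmx v)) = rsubmx v := rc _ dn.
  apply: filterS2 ln rn => v [cl El] [dr Er].
  by split => //; rewrite El Er hsubmxK.
Qed.

(** The set on which [smooth_map] gives smoothness is a neighbourhood of [chmap c u], by continuity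
    of [f], so its interior can be used. Only [chart_near] is asked of [c], so that product charts
    qualify. *)
Lemma smooth_map_at (M N : topologicalType) m n (A : atlas R M m)
    (B : atlas R N n) f c d u : smooth_map A B f -> A c -> B d ->
  chart_near c u -> nbhs (f u) (chdom d) ->
  smooth_at (chmap d \o f \o chinv c) (chmap c u).
Proof.
move=> [cf sf] Ac Bd [cK cc cn] du.
set S := chmap c @` (chdom c `&` f @^-1` chdom d).
have nS : nbhs (chmap c u) S.
  have fd : \forall p \near chmap c u, chdom d (f (chinv c p)).
    have : {for chmap c u, continuous (f \o chinv c)}.
      by apply: continuous_comp => //; exact: cf.
    by rewrite /prop_for /continuous_at /= cK; apply.
  by apply: filterS2 cn fd => p [cp pE] dp; exists (chinv c p).
apply: (@smooth_on_at _ _ _ S°); [exact: open_interior|exact: nS|].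
by move=> k; apply: Ck_sub (sf _ _ Ac Bd k); exact: interior_subset.
Qed.

End charts.

(** * Smoothness of maps read in the charts of an atlas *)

Section manifold.
Context {R : realType} (M : topologicalType) (m : nat) (A : atlas R M m).
Hypothesis hM : smooth_manifold A.

Lemma atlas_chart_near c u : A c -> chdom c u -> chart_near c u.
Proof. by move=> Ac; apply: is_chart_near; exact: manifold_charts hM _ Ac. Qed.

Lemma nbhs_chdom c u : A c -> chdom c u -> nbhs u (chdom c).
Proof.
move=> Ac cu; apply: open_nbhs_nbhs; split => //.
exact: chart_open (manifold_charts hM Ac).
Qed.

Lemma chart_at_prop u : A (chart_at A u) /\ chdom (chart_at A u) u.
Proof.
apply: (xgetPex _ (P := [set c | A c /\ chdom c u])).
by have [c] := manifold_cover hM u; exists c.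
Qed.

Lemma transition_smooth_at c d u : A c -> A d -> chdom c u -> chdom d u ->
  smooth_at (chmap d \o chinv c) (chmap c u).
Proof.
move=> Ac Ad cu du; have [cK cc cn] := atlas_chart_near Ac cu.
set S := chmap c @` (chdom c `&` chdom d).
have nS : nbhs (chmap c u) S.
  have dn : \forall p \near chmap c u, chdom d (chinv c p).
    by apply: cc; rewrite cK; exact: nbhs_chdom.
  by apply: filterS2 cn dn => p [cp pE] dp; exists (chinv c p).
apply: (@smooth_on_at _ _ _ S°); [exact: open_interior|exact: nS|].
move=> k; apply: Ck_sub (manifold_transition hM Ac Ad k); exact: interior_subset.
Qed.

Lemma Omega0P n (y : M -> 'rV[R]_n) : Omega0 n A y <->
  forall c u, A c -> chdom c u -> smooth_at (y \o chinv c) (chmap c u).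
Proof.
split=> [sy c u Ac cu|sy].
  apply: (@smooth_map_at _ _ _ _ _ _ _ y c (Chart setT id id) u sy Ac erefl).
    exact: atlas_chart_near.
  exact: filterT.
(* Continuity of [y] has to be recovered: near [u], [y] factors as its reading in a chart after the
   chart map. *)
split=> [u|c d Ac ->].
  have [Ac cu] := chart_at_prop u; move: (chart_at A u) Ac cu => c Ac cu.
  have [cK _ _] := atlas_chart_near Ac cu.
  have yE : \near u, (y \o chinv c \o chmap c) u = y u.
    apply: filterS (nbhs_chdom Ac cu) => w cw /=.
    by have [->] := atlas_chart_near Ac cw.
  have : {for u, continuous (y \o chinv c \o chmap c)}.
    apply: continuous_comp; first exact: (chart_continuous (manifold_charts hM Ac)).
    exact/smooth_at_continuous/sy.
  rewrite /continuous_at /prop_for (nbhs_singleton yE) => H.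
  by apply: cvg_trans H; exact: near_eq_cvg.
by apply: smooth_at_on => _ [u [cu _] <-]; exact: sy.
Qed.

End manifold.

(** * Derivatives along orbits *)

Lemma scale_add_subACA (R : pzRingType) (V : lmodType R) (t : R) (v w v' w' : V) :
  t *: v + w - (t *: v' + w') = t *: (v - v') + (w - w').
Proof. by rewrite scalerBr opprD addrACA. Qed.

(** The Jacobi identity for commutators, fully expanded: each of the six words occurs twice, with
    opposite signs. *)
Lemma cyclic_commutator_sum (V : zmodType) (x123 x132 x231 x213 x312 x321 : V) :
  x123 - x132 - (x231 - x321) + (x231 - x213 - (x312 - x132)) +
  (x312 - x321 - (x123 - x213)) = 0.
Proof.
have subACA (a b c d : V) : a - b - (c - d) = a + d - (b + c).
  by rewrite opprB addrACA -opprD.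
rewrite !subACA (addrC x231) (addrC x312 x213) (addrC x321) subrKA subrKA.
by rewrite subrr.
Qed.

Section orbital.
Context {R : realType} (G : groupTopologicalType) (n : nat) (AG : atlas R G n).
Hypothesis hG : lie_group AG.

Let c := chart_at AG (1%g : G).
Let e0 := coord_at AG (1%g : G).

Lemma chart1_near : chart_near c 1%g.
Proof.
have [Ac c1] := chart_at_prop (lie_group_manifold hG) 1%g.
exact: (atlas_chart_near (lie_group_manifold hG)).
Qed.

Definition orbit_map (M V : Type) (act : G -> M -> M) (y : M -> V) (u : M)
  (q : 'rV[R]_n) : V := y (act (chinv c q) u).

(** The derivative of [y] along the fundamental vector field of [a]. It is taken at [e0], the
    coordinates of the unit, in a chart of the group, so the exponential map enters only in
    [lambda_starE]. *)
Definition orbital_derivative (M : Type) (F : normedModType R)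
    (act : G -> M -> M) (a : 'rV[R]_n) (y : M -> F) (u : M) : F :=
  'D_a (orbit_map act y u) e0.

Section action.
Variables (M : topologicalType) (m : nat) (AM : atlas R M m).
Hypothesis hM : smooth_manifold AM.
Variable act : G -> M -> M.
Hypothesis hact : left_action AG AM act.
Implicit Types F : normedModType R.

Local Notation L := (orbital_derivative act).

Lemma orbit_map0 V (y : M -> V) u : orbit_map act y u e0 = y u.
Proof.
by rewrite /orbit_map (near_cancel chart1_near) (action_one hact).
Qed.

Lemma act_continuous g u : {for g, continuous (act^~ u)}.
Proof.
have pc : {for g, continuous (fun h => (h, u))}.
  by move=> U; apply: cvg_pair; [exact: cvg_id|exact: cvg_cst].
exact: (continuous_comp pc ((action_smooth hact).1 (g, u))).
Qed.

Lemma orbit_continuous u (V : set M) :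
  nbhs u V -> \forall q \near e0, V (act (chinv c q) u).
Proof.
move=> uV.
have ac : {for e0, continuous (act^~ u \o chinv c)}.
  apply: continuous_comp; first exact: near_inv_continuous chart1_near.
  exact: act_continuous.
by apply: ac; rewrite /= (near_cancel chart1_near) (action_one hact).
Qed.

(** Joint smoothness in the group element and the point, both read in charts and glued into one row
    vector. It comes from the smoothness of the action on the product manifold. *)
Lemma smooth_at_two_var F (y : M -> F) d u : AM d -> chdom d u ->
  smooth_at (y \o chinv d) (chmap d u) ->
  smooth_at (fun v => y (act (chinv c (lsubmx v)) (chinv d (rsubmx v))))
    (row_mx e0 (chmap d u)).
Proof.
move=> Ad du sy; have [Ac c1] := chart_at_prop (lie_group_manifold hG) 1%g.
have dn := atlas_chart_near hM Ad du.
have pn := prod_chart_near chart1_near dn.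
have nd : nbhs (act 1%g u) (chdom d).
  by rewrite (action_one hact); exact: (nbhs_chdom hM).
have As : prod_atlas AG AM (prod_chart c d) by exists c, d.
have sA := smooth_map_at (action_smooth hact) As Ad pn nd.
(* Inserting [chinv d] after [chmap d] changes nothing as long as the moved point stays in
   [chdom d], which continuity of the action ensures near the base point. *)
have yd : \forall v \near row_mx e0 (chmap d u),
    (y \o chinv d) (chmap d (act (chinv c (lsubmx v)) (chinv d (rsubmx v)))) =
    y (act (chinv c (lsubmx v)) (chinv d (rsubmx v))).
  have : \forall v \near row_mx e0 (chmap d u),
      chdom d (act (chinv c (lsubmx v)) (chinv d (rsubmx v))).
    have pc : {for row_mx e0 (chmap d u), continuous
        ((fun p => act p.1 p.2) \o chinv (prod_chart c d))}.
      apply: continuous_comp; first exact: near_inv_continuous pn.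
      exact: (action_smooth hact).1.
    apply: pc; rewrite /= row_mxKl row_mxKr (near_cancel chart1_near).
    by rewrite (near_cancel dn).
  apply: filterS => v dv /=.
  by rewrite (near_cancel (atlas_chart_near hM Ad dv)).
apply: smooth_at_eq yd _; apply: (smooth_at_comp sA).
rewrite /= row_mxKl row_mxKr (near_cancel chart1_near) (near_cancel dn).
by rewrite (action_one hact).
Qed.

Lemma smooth_at_orbit_map F (y : M -> F) d u : AM d -> chdom d u ->
  smooth_at (y \o chinv d) (chmap d u) -> smooth_at (orbit_map act y u) e0.
Proof.
move=> Ad du sy; have dn := atlas_chart_near hM Ad du.
rewrite (_ : orbit_map act y u =
    (fun v => y (act (chinv c (lsubmx v)) (chinv d (rsubmx v)))) \o
    (fun q => row_mx q (chmap d u))).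
  apply: smooth_at_comp; last exact: smooth_at_two_var.
  by apply: smooth_at_row_mx; [exact: smooth_at_id|exact: smooth_at_cst].
by apply/funext => q; rewrite /orbit_map /= row_mxKl row_mxKr (near_cancel dn).
Qed.

(** In coordinates this is the derivative of the joint map [H] in the direction [row_mx b 0],
    restricted to the slice over [e0]. *)
Lemma smooth_at_orbital_derivative F (y : M -> F) b d u : AM d -> chdom d u ->
  smooth_at (y \o chinv d) (chmap d u) ->
  smooth_at (L b y \o chinv d) (chmap d u).
Proof.
move=> Ad du sy; pose H v := y (act (chinv c (lsubmx v)) (chinv d (rsubmx v))).
rewrite (_ : _ \o _ = 'D_(row_mx b 0) H \o row_mx e0).
  apply: smooth_at_comp; last exact/smooth_at_derive/smooth_at_two_var.
  by apply: smooth_at_row_mx; [exact: smooth_at_cst|exact: smooth_at_id].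
apply/funext => p; rewrite /= -derive_row_mxl; congr ('D_b _ e0).
by apply/funext => q; rewrite /H row_mxKl row_mxKr.
Qed.

Lemma orbital_derivative_linear F (y : M -> F) d u a v w : AM d -> chdom d u ->
  smooth_at (y \o chinv d) (chmap d u) ->
  L (a *: v + w) y u = a *: L v y u + L w y u.
Proof.
move=> Ad du sy; apply: derive_linear; apply: smooth_at_differentiable.
exact: smooth_at_orbit_map sy.
Qed.

(** Chain rule: near [e0] the orbit map of [y] is [y \o chinv d] after the orbit map of [chmap d],
    whose derivative gives the coordinates of the fundamental field. *)
Lemma lie_derivativeE k (y : M -> 'rV[R]_k) u a :
  let d := chart_at AM u in smooth_at (y \o chinv d) (chmap d u) ->
  'D_(L a (chmap d) u) (y \o chinv d) (coord_at AM u) = L a y u.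
Proof.
move=> d sy; have [Ad du] := chart_at_prop hM u.
have dn := atlas_chart_near hM Ad du.
have sd : smooth_at (orbit_map act (chmap d) u) e0.
  exact: smooth_at_orbit_map (transition_smooth_at hM Ad Ad du du).
have E0 : orbit_map act (chmap d) u e0 = chmap d u by rewrite orbit_map0.
rewrite /coord_at -/d -E0 -derive_comp; first last.
- by rewrite E0; exact: smooth_at_differentiable.
- exact: smooth_at_differentiable.
apply: near_eq_derive.
have := orbit_continuous (nbhs_chdom hM Ad du).
apply: filterS => q dq; rewrite /= /orbit_map.
by rewrite (near_cancel (atlas_chart_near hM Ad dq)).
Qed.

End action.

(** * Left translations and the bracket at the unit *)

Lemma left_translation_action : left_action AG AG (fun g h : G => (g * h)%g).
Proof.
split; first exact: lie_group_mul.
- by move=> u; rewrite mul1g.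
- by move=> g h u; rewrite mulgA.
Qed.

Let lmul (g h : G) := (g * h)%g.
Let hlmul : left_action AG AG lmul := left_translation_action.
Let hGM := lie_group_manifold hG.

(* The right-invariant field of [b], read in the chart [c] around 1. *)
Definition local_field (b : 'rV[R]_n) (q : 'rV[R]_n) : 'rV[R]_n :=
  orbital_derivative lmul b (chmap c) (chinv c q).

Lemma smooth_at_chart_id g : chdom c g -> smooth_at (chmap c \o chinv c) (chmap c g).
Proof.
move=> cg; have [Ac _] := chart_at_prop hGM 1%g.
exact: (transition_smooth_at hGM Ac Ac cg cg).
Qed.

Lemma smooth_at_local_field b : smooth_at (local_field b) e0.
Proof.
have [Ac c1] := chart_at_prop hGM 1%g.
exact: (smooth_at_orbital_derivative hGM hlmul b Ac c1 (smooth_at_chart_id c1)).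
Qed.

(** Moving the unit by [q] gives back [q], so the orbit map of the chart is the identity near
    [e0]. *)
Lemma local_field0 b : local_field b e0 = b.
Proof.
rewrite /local_field (near_cancel chart1_near) -[RHS](derive_id e0).
apply: near_eq_derive; apply: filterS (near_image chart1_near) => q [_ qE].
by rewrite /orbit_map /lmul mulg1.
Qed.

Lemma local_field_linear a v w :
  \forall q \near e0,
    local_field (a *: v + w) q = a *: local_field v q + local_field w q.
Proof.
have [Ac _] := chart_at_prop hGM 1%g.
apply: filterS (near_image chart1_near) => q [cq _].
exact: (orbital_derivative_linear hGM hlmul _ _ _ Ac cq (smooth_at_chart_id cq)).
Qed.

Lemma right_invariant_field1 a : right_invariant_field AG a 1%g = a.
Proof.
rewrite -[RHS](derive_id e0) /right_invariant_field /tangent_map mulg1.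
apply: near_eq_derive; apply: filterS (near_image chart1_near) => q [_ qE].
by rewrite /= mulg1.
Qed.

(** The field at [chinv c q] is given in the chart chosen at that point, which may differ from [c].
    The change of charts is [lie_derivativeE] for the function [chmap c]. *)
Lemma field_in_chartE b : \forall q \near e0,
  field_in_chart AG (right_invariant_field AG b) c q = local_field b q.
Proof.
have [Ac _] := chart_at_prop hGM 1%g.
apply: filterS (near_image chart1_near) => q [cq qE].
rewrite /field_in_chart /right_invariant_field /tangent_map mul1g.
have [Ad dg] := chart_at_prop hGM (chinv c q).
exact: (lie_derivativeE hGM hlmul b (transition_smooth_at hGM Ad Ac dg cq)).
Qed.

Lemma lie_bracketE a b :
  lie_bracket AG a b = 'D_a (local_field b) e0 - 'D_b (local_field a) e0.
Proof.
have D v w : 'D_v (field_in_chart AG (right_invariant_field AG w) c) e0 =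
    'D_v (local_field w) e0.
  exact: near_eq_derive (field_in_chartE w).
rewrite /lie_bracket /field_bracket !right_invariant_field1 -/c -/e0.
exact: (congr2 (fun v w => v - w) (D a b) (D b a)).
Qed.

Lemma lie_bracket_alternating a : lie_bracket AG a a = 0.
Proof. by rewrite lie_bracketE subrr. Qed.

Lemma lie_bracket_anti a b : lie_bracket AG a b = - lie_bracket AG b a.
Proof. by rewrite !lie_bracketE opprB. Qed.

Lemma lie_bracket_linearl b : linear ((lie_bracket AG)^~ b).
Proof.
move=> t v w; rewrite !lie_bracketE derive_linear; last first.
  exact/smooth_at_differentiable/smooth_at_local_field.
rewrite (near_eq_derive b (local_field_linear t v w)).
have d u : derivable (local_field u) e0 b.
  exact/diff_derivable/smooth_at_differentiable/smooth_at_local_field.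
rewrite [X in _ - X](_ : _ = t *: 'D_b (local_field v) e0 + 'D_b (local_field w) e0).
  exact: scale_add_subACA.
by rewrite -deriveZ// -deriveD//; exact: derivableZ.
Qed.

Lemma lie_bracket_linearr a : linear (lie_bracket AG a).
Proof.
move=> t v w; rewrite ![lie_bracket AG a _]lie_bracket_anti.
by rewrite lie_bracket_linearl opprD scalerN.
Qed.

(** * Commutators of derivatives along orbits *)

Section commutator.
Variables (M : topologicalType) (m : nat) (AM : atlas R M m).
Hypothesis hM : smooth_manifold AM.
Variable act : G -> M -> M.
Hypothesis hact : left_action AG AM act.

Local Notation L := (orbital_derivative act).

(** Since [p] acting on [q u] is [p q] acting on [u], moving the base point along the orbit amounts
    to moving [q] by left translations in the group. The velocity of that motion at [q] is
    [local_field b q]. *)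
Lemma orbital_derivative_along k (y : M -> 'rV[R]_k) b d u : AM d -> chdom d u ->
  smooth_at (y \o chinv d) (chmap d u) ->
  \forall q \near e0, L b y (act (chinv c q) u) =
    'D_(local_field b q) (orbit_map act y u) q.
Proof.
move=> Ad du sy; have [Ac _] := chart_at_prop hGM 1%g.
have sF := smooth_at_orbit_map hM hact Ad du sy.
apply: filterS2 (near_image chart1_near) (smooth_at_near sF) => q [cq qE] sFq.
have sq := smooth_at_orbit_map hGM hlmul Ac cq (smooth_at_chart_id cq).
have q0 : orbit_map lmul (chmap c) (chinv c q) e0 = q.
  by rewrite (orbit_map0 hlmul).
have dF : differentiable (orbit_map act y u) (orbit_map lmul (chmap c) (chinv c q) e0).
  by rewrite q0; exact: smooth_at_differentiable.
have := derive_comp b (smooth_at_differentiable sq) dF.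
rewrite q0 -/(local_field b q) => <-; apply: near_eq_derive.
apply: filterS (orbit_continuous hlmul (nbhs_chdom hGM Ac cq)) => p cp.
rewrite /= /orbit_map (near_cancel (atlas_chart_near hGM Ac cp)).
by rewrite (action_mul hact).
Qed.

(** Everything is pulled back to the orbit map at [e0]. There [derive_field] produces a second
    derivative, which Schwarz cancels in the commutator, and a first derivative along the derivative
    of a local field; by [lie_bracketE] the difference of the latter is the bracket term. *)
Lemma orbital_commutator k (y : M -> 'rV[R]_k) a b d u : AM d -> chdom d u ->
  smooth_at (y \o chinv d) (chmap d u) ->
  L a (L b y) u - L b (L a y) u = L (lie_bracket AG a b) y u.
Proof.
move=> Ad du sy; have sF := smooth_at_orbit_map hM hact Ad du sy.
have E v w : L v (L w y) u = 'D_v ('D_w (orbit_map act y u)) e0 +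
    'D_('D_v (local_field w) e0) (orbit_map act y u) e0.
  rewrite [LHS](near_eq_derive v (orbital_derivative_along w Ad du sy)).
  by rewrite (derive_field v (smooth_at_local_field w) sF) local_field0.
have dF := smooth_at_differentiable sF.
have S := schwarz_at a b sF.
have C (V : zmodType) (x p q : V) : x + p - (x + q) = p - q.
  by rewrite (addrC x p) addrKA.
rewrite (E a b) (E b a) S C lie_bracketE /orbital_derivative.
by rewrite (derive_dirB _ _ dF).
Qed.

End commutator.

(** By [L1] a vector is recovered from its operator [L] by applying it to the chart at the unit, so
    brackets become commutators of operators on the chart. *)
Lemma lie_bracket_jacobi a1 a2 a3 :
  lie_bracket AG a1 (lie_bracket AG a2 a3) +
  lie_bracket AG a2 (lie_bracket AG a3 a1) +
  lie_bracket AG a3 (lie_bracket AG a1 a2) = 0.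
Proof.
pose L := orbital_derivative (F := 'rV[R]_n) lmul; pose x := chmap c.
have [Ac c1] := chart_at_prop hGM 1%g.
have sx g : chdom c g -> smooth_at (x \o chinv c) (x g) by exact: smooth_at_chart_id.
have sL v y g : chdom c g -> smooth_at (y \o chinv c) (x g) ->
    smooth_at (L v y \o chinv c) (x g).
  by move=> cg; exact: (smooth_at_orbital_derivative hGM hlmul).
have L1 v : L v x 1%g = v.
  by rewrite -[RHS]local_field0 /local_field (near_cancel chart1_near).
have K v w y g : chdom c g -> smooth_at (y \o chinv c) (x g) ->
    L v (L w y) g - L w (L v y) g = L (lie_bracket AG v w) y g.
  by move=> cg; exact: (orbital_commutator hGM hlmul).
have J v w z : lie_bracket AG v (lie_bracket AG w z) =
    L v (L w (L z x)) 1%g - L v (L z (L w x)) 1%g -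
    (L w (L z (L v x)) 1%g - L z (L w (L v x)) 1%g).
  rewrite -[LHS]L1 -K//; last exact: sx.
  congr (_ - _); last by rewrite K//; apply: sL => //; exact: sx.
  (* The inner commutator identity holds only on the chart domain; this suffices under [L v], which
     sees values near the unit. *)
  have D u1 u2 : derivable (orbit_map lmul (L u1 (L u2 x)) 1%g) e0 v.
    apply/diff_derivable/smooth_at_differentiable.
    exact: (smooth_at_orbit_map hGM hlmul Ac c1 (sL _ _ _ c1 (sL _ _ _ c1 (sx _ c1)))).
  rewrite [RHS](_ : _ = 'D_v (orbit_map lmul (L w (L z x)) 1%g -
    orbit_map lmul (L z (L w x)) 1%g) e0); last by rewrite deriveB.
  apply: near_eq_derive; apply: filterS (near_image chart1_near) => q [cq _].
  by rewrite /orbit_map !fctE /lmul mulg1 K//; exact: sx.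
rewrite !J.
exact: cyclic_commutator_sum.
Qed.

End orbital.

(** * The post-Lie structure on Omega^0 *)

Section omega.
Context {R : realType} (G : groupTopologicalType) (n : nat) (AG : atlas R G n).
Hypothesis hG : lie_group AG.
Variable expG : 'rV[R]_n -> G.
Hypothesis hexp : exponential_map AG expG.
Variables (M : topologicalType) (m : nat) (AM : atlas R M m).
Hypothesis hM : smooth_manifold AM.
Variable act : G -> M -> M.
Hypothesis hact : left_action AG AM act.

Let c := chart_at AG (1%g : G).
Let e0 := coord_at AG (1%g : G).
Local Notation L := (orbital_derivative AG act).
Local Notation tr := (omega_product expG AM act).
Local Notation br := (omega_bracket AG).

Lemma exp0 a : expG (0 *: a) = 1%g.
Proof.
have := exp_morphism hexp a 0 0; rewrite addr0.
by rewrite -{1}[expG _]mulg1 => /mulgI.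
Qed.

(** The exponential curve read in the chart [c] passes through [e0] at time 0 with velocity [x u],
    so the chain rule replaces it by the derivative of the orbit map in that direction. *)
Lemma lambda_starE x u :
  lambda_star expG AM act x u = L (x u) (chmap (chart_at AM u)) u.
Proof.
have [Ac c1] := chart_at_prop (lie_group_manifold hG) 1%g.
have [Ad du] := chart_at_prop hM u.
set a := x u; pose g t : 'rV[R]_n := chmap c (expG (t *: a)).
have [ec es] := exp_smooth hexp a.
have cexp : \forall t \near 0, chdom c (expG (t *: a)).
  by apply: ec; rewrite exp0; exact: (nbhs_chdom (lie_group_manifold hG)).
have dg : differentiable g 0.
  by have [+ _] := es _ Ac 1%N; apply; rewrite /= exp0.
have g0 : g 0 = e0 by rewrite /g exp0.
have gv : 'D_1 g 0 = a.
  by rewrite -derive1E -[RHS](exp_velocity hexp) /velocity0 exp0.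
have sd : smooth_at (orbit_map AG act (chmap (chart_at AM u)) u) e0.
  apply: (smooth_at_orbit_map hG hM hact Ad du).
  exact: (transition_smooth_at hM Ad Ad du du).
have dd : differentiable (orbit_map AG act (chmap (chart_at AM u)) u) (g 0).
  by rewrite g0; exact: smooth_at_differentiable.
rewrite /lambda_star /velocity0 exp0 (action_one hact) derive1E.
have := derive_comp (1 : R) dg dd; rewrite gv g0; apply: etrans.
apply: near_eq_derive.
 apply: filterS cexp => t ct.
rewrite /= /orbit_map /g.
by rewrite (near_cancel (atlas_chart_near (lie_group_manifold hG) Ac ct)).
Qed.

Lemma omega_productE (x y : M -> 'rV[R]_n) u : Omega0 n AM y -> tr x y u = L (x u) y u.
Proof.
move=> /(Omega0P hM) sy; have [Ad du] := chart_at_prop hM u.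
rewrite /omega_product /lie_derivative lambda_starE.
exact: (lie_derivativeE hG hM hact (x u) (sy _ _ Ad du)).
Qed.

Lemma Omega0_orbit_map y u : Omega0 n AM y -> smooth_at (orbit_map AG act y u) e0.
Proof.
move=> /(Omega0P hM) sy; have [Ad du] := chart_at_prop hM u.
exact: (smooth_at_orbit_map hG hM hact Ad du (sy _ _ Ad du)).
Qed.

Lemma Omega0_orbital_derivative a y : Omega0 n AM y -> Omega0 n AM (L a y).
Proof.
move=> /(Omega0P hM) sy; apply/(Omega0P hM) => d u Ad du.
exact: (smooth_at_orbital_derivative hG hM hact a Ad du (sy _ _ Ad du)).
Qed.

(** Separates the direction, which varies with the point in [x |> y], from finitely many operators
    with constant direction that preserve [Omega0]. *)
Lemma orbital_derivative_sum a y u : Omega0 n AM y ->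
  L a y u = \sum_(i < n) a 0 i *: L (delta_mx 0 i) y u.
Proof.
by move=> sy; apply: derive_rowE; exact/smooth_at_differentiable/Omega0_orbit_map.
Qed.

Lemma omega_product_closed x y :
  Omega0 n AM x -> Omega0 n AM y -> Omega0 n AM (tr x y).
Proof.
move=> sx sy.
have -> : tr x y = fun u => \sum_(i < n) x u 0 i *: L (delta_mx 0 i) y u.
  by apply/funext => u; rewrite omega_productE// orbital_derivative_sum.
apply/(Omega0P hM) => d u Ad du.
apply: (@smooth_at_sum _ _ _ n
  (fun i p => x (chinv d p) 0 i *: L (delta_mx 0 i) y (chinv d p))) => i.
apply: smooth_at_scale; last first.
  by have /(Omega0P hM) := Omega0_orbital_derivative (delta_mx 0 i) sy; exact.
by apply: (@smooth_at_coord _ _ _ (x \o chinv d)); move/(Omega0P hM) : sx; apply.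
Qed.

Lemma omega_bracket_closed x y :
  Omega0 n AM x -> Omega0 n AM y -> Omega0 n AM (br x y).
Proof.
move=> /(Omega0P hM) sx /(Omega0P hM) sy; apply/(Omega0P hM) => d u Ad du.
apply: (smooth_at_bilinear (lie_bracket_linearl hG) (lie_bracket_linearr hG)).
  exact: sx.
exact: sy.
Qed.

Lemma Omega0_linear a x y :
  Omega0 n AM x -> Omega0 n AM y -> Omega0 n AM (a *: x + y).
Proof.
move=> /(Omega0P hM) sx /(Omega0P hM) sy; apply/(Omega0P hM) => d u Ad du.
by apply: smooth_atD; [apply: smooth_atZ; exact: sx|exact: sy].
Qed.

Lemma omega_product_linearr a x y z : Omega0 n AM x -> Omega0 n AM y ->
  Omega0 n AM z -> tr x (a *: y + z) = a *: tr x y + tr x z.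
Proof.
move=> sx sy sz; apply/funext => u; rewrite !fctE !omega_productE//; last first.
  exact: Omega0_linear.
have dy : derivable (orbit_map AG act y u) e0 (x u).
  exact/diff_derivable/smooth_at_differentiable/Omega0_orbit_map.
have dz : derivable (orbit_map AG act z u) e0 (x u).
  exact/diff_derivable/smooth_at_differentiable/Omega0_orbit_map.
by have := deriveD (@derivableZ _ _ _ _ a _ _ dy) dz; rewrite (deriveZ _ dy).
Qed.

Lemma omega_product_linearl a x y z : Omega0 n AM x -> Omega0 n AM y ->
  Omega0 n AM z -> tr (a *: x + y) z = a *: tr x z + tr y z.
Proof.
move=> sx sy sz; apply/funext => u; rewrite !fctE !omega_productE//.
by apply: derive_linear; exact/smooth_at_differentiable/Omega0_orbit_map.
Qed.

Lemma omega_product_derivation x y z : Omega0 n AM x -> Omega0 n AM y ->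
  Omega0 n AM z -> tr x (br y z) = br (tr x y) z + br y (tr x z).
Proof.
move=> sx sy sz; apply/funext => u; rewrite !fctE.
rewrite omega_productE; last exact: omega_bracket_closed.
rewrite /omega_bracket !omega_productE//.
have := derive_bilinear (lie_bracket_linearl hG) (lie_bracket_linearr hG) (x u)
  (Omega0_orbit_map u sy) (Omega0_orbit_map u sz).
by rewrite !(orbit_map0 hG hact).
Qed.

(** Differentiating [tr y z] along the orbit also differentiates the direction [y]; this extra term
    is exactly [tr (tr x y) z] and cancels in the associator. *)
Lemma omega_associatorE x y z u : Omega0 n AM x -> Omega0 n AM y ->
  Omega0 n AM z -> associator tr x y z u = L (x u) (L (y u) z) u.
Proof.
move=> sx sy sz.
have sLz i := Omega0_orbital_derivative (delta_mx 0 i) sz.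
have sF i := Omega0_orbit_map u (sLz i); have sY := Omega0_orbit_map u sy.
have dF i := smooth_at_differentiable (sF i).
have dY i : differentiable (fun q => orbit_map AG act y u q 0 i) e0.
  exact/smooth_at_differentiable/smooth_at_coord.
(* Used twice: with [w] constant equal to [y u], where the second sum vanishes, and with [w] the
   orbit map of [y]. *)
have E (w : 'rV[R]_n -> 'rV[R]_n) : (forall i, differentiable (fun q => w q 0 i) e0) ->
    'D_(x u) (fun q => L (w q) z (act (chinv c q) u)) e0 =
    \sum_(i < n) w e0 0 i *: L (x u) (L (delta_mx 0 i) z) u +
    \sum_(i < n) 'D_(x u) (fun q => w q 0 i) e0 *: L (delta_mx 0 i) z u.
  move=> dw; rewrite (_ : (fun q => _) = fun q =>
      \sum_(i < n) w q 0 i *: orbit_map AG act (L (delta_mx 0 i) z) u q); last first.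
    by apply/funext => q; rewrite orbital_derivative_sum.
  apply: etrans (derive_scale_sum (x u) dw dF) _.
  apply: (congr2 +%R erefl); apply: eq_bigr => i _.
  by rewrite (orbit_map0 hG hact).
have -> : L (x u) (L (y u) z) u =
    \sum_(i < n) y u 0 i *: L (x u) (L (delta_mx 0 i) z) u.
  rewrite [LHS](E (fun=> y u)) => [|i]; last exact: differentiable_cst.
  by rewrite [X in _ + X]big1 ?addr0// => i _; rewrite derive_cst scale0r.
rewrite /associator !fctE omega_productE; last exact: omega_product_closed.
rewrite (omega_productE (tr x y) u sz) (omega_productE x u sy).
have -> : L (x u) (tr y z) u =
    'D_(x u) (fun q => L (orbit_map AG act y u q) z (act (chinv c q) u)) e0.
  by congr ('D_(x u) _ e0); apply/funext => q; rewrite /orbit_map omega_productE.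
rewrite (E _ dY) (orbit_map0 hG hact) [L (L _ _ _) z u]orbital_derivative_sum//.
rewrite [X in _ + X - _](_ : _ =
    \sum_(i < n) L (x u) y u 0 i *: L (delta_mx 0 i) z u).
  by rewrite addrK.
apply: eq_bigr => i _; congr (_ *: _); rewrite [RHS]derive_coord//.
exact: smooth_at_differentiable.
Qed.

End omega.

Theorem proposition2p10 (R : realType)
  (G : groupTopologicalType) (n : nat) (AG : atlas R G n)
  (hG : lie_group AG)
  (expG : 'rV[R]_n -> G) (hexp : exponential_map AG expG)
  (M : topologicalType) (m : nat) (AM : atlas R M m)
  (hM : smooth_manifold AM)
  (act : G -> M -> M) (hact : left_action AG AM act) :
  post_lie_algebra_on (Omega0 n AM) (omega_bracket AG)
    (omega_product expG AM act).
Proof.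
split; first split.
- by apply/(Omega0P hM) => d u _ _; exact: smooth_at_cst.
- by move=> a x y; exact: Omega0_linear.
- by move=> x y; exact: omega_bracket_closed.
- by move=> a x y z _ _ _; apply/funext => u; exact: (lie_bracket_linearl hG).
- by move=> a x y z _ _ _; apply/funext => u; exact: (lie_bracket_linearr hG).
- by move=> x _; apply/funext => u; exact: (lie_bracket_alternating hG).
- by move=> x y z _ _ _; apply/funext => u; exact: (lie_bracket_jacobi hG).
- by move=> x y; exact: (omega_product_closed hG hexp hM hact).
- by move=> a x y z; exact: (omega_product_linearl hG hexp hM hact).
- by move=> a x y z; exact: (omega_product_linearr hG hexp hM hact).
- by move=> x y z; exact: (omega_product_derivation hG hexp hM hact).
move=> x y z sx sy sz; apply/funext => u; rewrite !fctE.
rewrite (omega_productE hG hexp hM hact)// !(omega_associatorE hG hexp hM hact)//.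
have [Ad du] := chart_at_prop hM u.
have /(Omega0P hM) sz' := sz; symmetry.
exact: (orbital_commutator hG hM hact _ _ Ad du (sz' _ _ Ad du)).
Qed.
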